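(* Let $G$ be a connected graph of diameter $d$. If $k$ is an integer with $2\le k\le d$, then $$\mathrm{gp}_k(G)\ge\begin{cases} 2\left\lceil\frac{d+1}{k+1}\right\rceil-1, & d\equiv 0 \pmod{k+1},\\[0.2cm] 2\left\lceil\frac{d+1}{k+1}\right\rceil, & \text{otherwise.}\end{cases}$$
   Context: Graphs are finite, simple, undirected. $d_G(u,w)$ denotes the shortest-path distance in $G$, and $I_G(u,w)=\{x\in V(G): d_G(u,w)=d_G(u,x)+d_G(x,w)\}$. For a positive integer $k$, a set $S\subseteq V(G)$ is a general $k$-position set if for any three distinct vertices $u,v,w\in S$ with $v\in I_G(u,w)$ we have $d_G(u,w)>k$. $\mathrm{gp}_k(G)$ is the cardinality of a largest general $k$-position set of $G$. *)

(* Defs.v *)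
From mathcomp Require Import all_boot all_order all_algebra.

Set Implicit Arguments.
Unset Strict Implicit.
Unset Printing Implicit Defensive.

(* A finite simple graph is a finite type T of vertices together with a
   symmetric and irreflexive adjacency relation e : rel T. *)

Definition graph_connected (T : finType) (e : rel T) : Prop :=
  forall u w : T, connect e u w.

(* The sequence p lists the vertices after u, so it has as many items as the
   path u :: p has edges. *)
Definition has_path_of_length (T : finType) (e : rel T) (u w : T) (n : nat) :
    bool :=
  [exists p : n.-tuple T, [&& path e u p, uniq (u :: p) & last u p == w]].

(* A path has fewer than #|T| edges; the value #|T| is taken exactly when no
   path joins u to w. *)
Definition gdist (T : finType) (e : rel T) (u w : T) : nat :=
  find (has_path_of_length e u w) (iota 0 #|T|).

Definition diameter (T : finType) (e : rel T) : nat :=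
  \max_(u : T) \max_(w : T) gdist e u w.

Definition ginterval (T : finType) (e : rel T) (u w : T) : {set T} :=
  [set x | gdist e u w == gdist e u x + gdist e x w].

Definition general_position (T : finType) (e : rel T) (k : nat) (S : {set T}) :
    bool :=
  [forall u in S, forall v in S, forall w in S,
     [&& u != v, v != w, u != w & v \in ginterval e u w] ==>
       (k < gdist e u w)].

Definition gp (T : finType) (e : rel T) (k : nat) : nat :=
  \max_(S : {set T} | general_position e k S) #|S|.

(* Main.v *)
Require Import Defs.
From mathcomp Require Import all_boot all_order all_algebra.
From mathcomp Require Import zify.

Import Order.TTheory GRing.Theory Num.Theory.

(** Fix two vertices at distance [d], the diameter, and a shortest path
    [v 0, ..., v d] between them.  Such a path is isometric: the distance from
    [v i] to [v j] is [|i - j|] ([diametral_path]), so betweenness for vertices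
    of the path is betweenness for their indices.  A set of indices therefore
    gives a general [k]-position set as soon as any three of its elements span
    more than [k].

    The indices congruent to [0] or [1] modulo [k + 1] have this property.  In
    increasing order they are [0, 1, k+1, k+2, 2(k+1), ...]; going two places
    further in this list ([pair_pos]) adds exactly [k + 1], so the outer two of
    any three entries differ by at least [k + 1].  It remains to count the
    entries that are at most [d]: each of the [ceil ((d+1)/(k+1))] blocks of
    [k + 1] consecutive indices contributes two, except that the last block is
    reduced to the single index [d] when [k + 1] divides [d]. *)

Section Distance.

Variables (T : finType) (e : rel T).

(** The distance is defined by a search among paths without repeated vertices;
    removing the loops of an arbitrary path gives such a path, short enough to
    be inside the range of the search. *)
Lemma gdist_le_size (u : T) (p : seq T) :
  path e u p -> gdist e u (last u p) <= size p.
Proof.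
move=> /shortenP[q eq_q uniq_q sub_qp].
have size_qT : size q < #|T| by rewrite -[(size q).+1](card_uniqP uniq_q) max_card.
have has_q : has_path_of_length e u (last u q) (size q).
  by apply/existsP; exists (in_tuple q); rewrite eq_q uniq_q /=.
apply: (@leq_trans (size q)); last first.
  by apply: uniq_leq_size => //; case/andP: uniq_q.
rewrite leqNgt; apply/negP => /(before_find 0).
by rewrite nth_iota // add0n has_q.
Qed.

Lemma gdistxx (u : T) : gdist e u u = 0.
Proof. by apply/eqP; rewrite -leqn0; apply: (@gdist_le_size u [::]). Qed.

Lemma gdist_edge (u w : T) : e u w -> gdist e u w <= 1.
Proof. by move=> euw; apply: (@gdist_le_size u [:: w]); rewrite /= euw. Qed.

Hypothesis e_conn : graph_connected e.

Lemma exists_geodesic (u w : T) :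
  exists p : seq T, [/\ path e u p, last u p = w & size p = gdist e u w].
Proof.
have has_dist : has (has_path_of_length e u w) (iota 0 #|T|).
  have /connectP[p0 ep0 ->] := e_conn u w.
  have [q eq_q uniq_q _] := shortenP ep0.
  apply/hasP; exists (size q).
    by rewrite mem_iota /= add0n -[(size q).+1](card_uniqP uniq_q) max_card.
  by apply/existsP; exists (in_tuple q); rewrite eq_q uniq_q /=.
have := nth_find 0 has_dist; rewrite nth_iota; last first.
  by move: has_dist; rewrite has_find size_iota.
rewrite add0n => /existsP[p /and3P[ep _ /eqP last_p]].
by exists p; rewrite size_tuple.
Qed.

Lemma gdist_triangle (x u w : T) : gdist e u w <= gdist e u x + gdist e x w.
Proof.
have [p [ep last_p <-]] := exists_geodesic u x.
have [q [eq_q last_q <-]] := exists_geodesic x w.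
rewrite -size_cat -last_q -last_p -last_cat; apply: gdist_le_size.
by rewrite cat_path ep last_p.
Qed.

Lemma gdistC (u w : T) : symmetric e -> gdist e u w = gdist e w u.
Proof.
move=> e_sym; suff le_dist x y : gdist e x y <= gdist e y x.
  by apply/eqP; rewrite eqn_leq !le_dist.
have [p [ep last_p <-]] := exists_geodesic y x.
have := @gdist_le_size (last y p) (rev (belast y p)).
rewrite size_rev size_belast rev_path (eq_path (e' := e)); last first.
  by move=> a b; rewrite e_sym.
move=> /(_ ep); rewrite last_p; congr (gdist e x _ <= _).
by case: p {ep} last_p => [|z s] /= last_p; rewrite ?rev_cons ?last_rcons.
Qed.

(** Distances along a geodesic are exact: consecutive vertices are at distance
    at most [1], so no two vertices are farther apart than their indices; were
    two of them closer, the triangle inequality through them would bring the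
    endpoints closer than the length of the path.  With truncated subtraction,
    one summand of [(i - j) + (j - i)] vanishes and the other is [|i - j|]. *)
Lemma isometric_path (u w : T) : symmetric e ->
  exists v : nat -> T, forall i j, i <= gdist e u w -> j <= gdist e u w ->
    gdist e (v i) (v j) = (i - j) + (j - i).
Proof.
move=> e_sym; have [p [ep last_p size_p]] := exists_geodesic u w.
pose v i := nth u (u :: p) i; exists v.
have v_end : v (gdist e u w) = w by rewrite -size_p /v -last_nth last_p.
have upper n : forall i, i + n <= gdist e u w -> gdist e (v i) (v (i + n)) <= n.
  elim: n => [|n IHn] i; first by rewrite addn0 gdistxx.
  rewrite addnS => lt_in.
  apply: leq_trans (gdist_triangle (v (i + n)) _ _) _.
  rewrite -[X in _ <= X]addn1; apply: leq_add; first exact/IHn/ltnW.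
  by apply: gdist_edge; apply: (pathP u ep); rewrite size_p.
have ordered i j : i <= j -> j <= gdist e u w -> gdist e (v i) (v j) = j - i.
  move=> le_ij le_jd; apply/eqP; rewrite eqn_leq; apply/andP; split.
    by rewrite -{1}(subnKC le_ij) upper // subnKC.
  have := upper i 0; have := upper (gdist e u w - j) j.
  rewrite subnKC // v_end add0n => /(_ (leqnn _)) wj /(_ (leq_trans le_ij le_jd)).
  have := gdist_triangle (v i) u w; have := gdist_triangle (v j) (v i) w.
  by rewrite (_ : v 0 = u) //; lia.
move=> i j le_id le_jd; case: (leqP i j) => [le_ij | /ltnW le_ji].
  by rewrite ordered //; lia.
by rewrite gdistC // ordered //; lia.
Qed.

Lemma diametral_path : 0 < diameter e -> symmetric e ->
  exists v : nat -> T, forall i j, i <= diameter e -> j <= diameter e ->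
    gdist e (v i) (v j) = (i - j) + (j - i).
Proof.
move=> d_gt0 e_sym.
have T_gt0 : 0 < #|T|.
  rewrite lt0n; apply: contraL d_gt0 => /eqP/card0_eq T0.
  by rewrite -leqNgt; apply/bigmax_leqP => u; have := T0 u.
rewrite /diameter.
have [u ->] := bigop.eq_bigmax (fun u : T => \max_w gdist e u w) T_gt0.
have [w ->] := bigop.eq_bigmax (gdist e u) T_gt0.
exact: isometric_path.
Qed.

End Distance.

(** The [j]-th number, in increasing order, that is congruent to [0] or [1]
    modulo [k + 1]. *)
Definition pair_pos (k j : nat) : nat := j./2 * k.+1 + odd j.

Lemma pair_pos_add2 (k j : nat) : pair_pos k j.+2 = pair_pos k j + k.+1.
Proof. by rewrite /pair_pos /= negbK; lia. Qed.

Lemma pair_pos_lt (k : nat) : 0 < k -> {homo pair_pos k : i j / i < j}.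
Proof.
move=> k_gt0; apply: homo_ltn => [y x z|i]; first exact: ltn_trans.
rewrite /pair_pos /= uphalf_half; case: (odd i) => /=; nia.
Qed.

Lemma pair_pos_le (k : nat) : 0 < k -> {mono pair_pos k : i j / i <= j}.
Proof. by move=> k_gt0; apply: leq_mono => i j; apply: pair_pos_lt. Qed.

Lemma pair_pos_gap (k a b c : nat) : 0 < k ->
  a < b -> b < c -> k < pair_pos k c - pair_pos k a.
Proof.
move=> k_gt0 lt_ab lt_bc.
have : pair_pos k a.+2 <= pair_pos k c by rewrite pair_pos_le //; lia.
by rewrite pair_pos_add2; lia.
Qed.

(** Betweenness of path vertices only says that one index lies between two
    others, in either direction; both directions reduce to the gap of at least
    [k + 1] between entries of [pair_pos] that are two or more places apart. *)
Lemma lt_gp (T : finType) (e : rel T) (k m : nat) :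
    symmetric e -> graph_connected e -> 0 < k -> 0 < diameter e ->
  pair_pos k m <= diameter e -> m < gp e k.
Proof.
move=> e_sym e_conn k_gt0 d_gt0 le_md.
have [v dist_v] := diametral_path _ _ e_conn d_gt0 e_sym.
pose f (j : 'I_m.+1) := v (pair_pos k j).
have dist_f i j : gdist e (f i) (f j) =
    (pair_pos k i - pair_pos k j) + (pair_pos k j - pair_pos k i).
  by apply: dist_v; apply: leq_trans le_md; rewrite pair_pos_le // -ltnS.
have f_inj : injective f.
  move=> i j eq_f; apply/val_inj/(incn_inj (pair_pos_le _ k_gt0)) => /=.
  by have := dist_f i j; rewrite eq_f gdistxx; lia.
rewrite -[m.+1]card_ord -cardsT -(card_imset _ f_inj).
apply: leq_bigmax_cond.
apply/forall_inP => _ /imsetP[a _ ->]; apply/forall_inP => _ /imsetP[b _ ->].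
apply/forall_inP => _ /imsetP[c _ ->]; apply/implyP.
rewrite !(inj_eq f_inj) inE !dist_f => /and4P[ne_ab ne_bc ne_ac /eqP between].
have lt_pos i j : i < j -> pair_pos k i < pair_pos k j by apply: pair_pos_lt.
have gap := @pair_pos_gap k _ _ _ k_gt0.
move: ne_ab ne_bc; rewrite -!val_eqE /= !neq_ltn.
case/orP=> ab /orP[] bc; have := lt_pos _ _ ab; have := lt_pos _ _ bc.
- by have := gap _ _ _ ab bc; lia.
- by lia.
- by lia.
- by have := gap _ _ _ bc ab; lia.
Qed.

Local Open Scope ring_scope.

Lemma ceil_divnS (d k : nat) :
  Num.ceil (d.+1%:R / k.+1%:R : rat) = (d %/ k.+1).+1%:Z.
Proof.
apply: ceil_def; rewrite ltr_pdivlMr ?ltr0n // ler_pdivrMr ?ltr0n //.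
rewrite -addn1 PoszD addrK -!pmulrn -!natrM ltr_nat ler_nat addn1.
by rewrite ltnS leq_trunc_div ltn_ceil.
Qed.

Theorem corollary3p2 (T : finType) (e : rel T)
    (e_sym : symmetric e) (e_irr : irreflexive e)
    (e_conn : graph_connected e)
    (d : nat) (d_diam : diameter e = d)
    (k : nat) (k_ge2 : (2 <= k)%N) (k_led : (k <= d)%N) :
  (if (d == 0 %[mod k.+1])%N
   then 2 * Num.ceil (d.+1%:R / k.+1%:R : rat) - 1
   else 2 * Num.ceil (d.+1%:R / k.+1%:R : rat))
  <= (gp e k)%:Z.
Proof.
have k_gt0 : (0 < k)%N by apply: ltnW.
have d_gt0 : (0 < diameter e)%N by rewrite d_diam (leq_trans k_gt0).
have bound m := @lt_gp T e k m e_sym e_conn k_gt0 d_gt0.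
rewrite ceil_divnS mod0n; have := divn_eq d k.+1.
set q := (d %/ k.+1)%N => d_eq.
case: ifP => [_ | /negbT r_neq0].
- (* Index d = q (k + 1) is itself entry 2q of pair_pos, the last that fits. *)
  have : (q.*2 < gp e k)%N.
    by apply: bound; rewrite /pair_pos doubleK odd_double d_diam; lia.
  by lia.
(* A nonzero remainder leaves room for the second index q (k + 1) + 1 of the
   last pair, which is entry 2q + 1. *)
have : (q.*2.+1 < gp e k)%N.
  by apply: bound; rewrite /pair_pos /= uphalf_double odd_double d_diam; lia.
by lia.
Qed.
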